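(* Let $\mathbb{C}$ be a category that has all equalizers, exponents and finite products, and let $\mathcal{T} = (T, \eta, \mu)$ be a (left) strong monad over $\mathbb{C}$ with left strength $\mathrm{lst}$. For every object $C$ of $\mathbb{C}$ and all $\mathcal{T}$-algebras $\bar{A} = (A, f_A)$ and $\bar{B} = (B, f_B)$ in the Eilenberg–Moore category $\mathbb{C}^{\mathcal{T}}$, there exists an object $\bar{A} \multimap \bar{B}$ of $\mathbb{C}$ such that $$\mathrm{AHom}_{\mathbb{C}}(C \times \bar{A}, \bar{B}) \cong \mathrm{Hom}_{\mathbb{C}}(C, \bar{A} \multimap \bar{B}),$$ i.e. there is a bijection between these two collections of morphisms.
   Context: A monad $\mathcal{T} = (T, \eta, \mu)$ over $\mathbb{C}$ consists of an endofunctor $T : \mathbb{C} \to \mathbb{C}$ and natural transformations $\eta : \mathrm{id}_{\mathbb{C}} \to T$ and $\mu : T^2 \to T$ with $\mu_A \circ T\mu_A = \mu_A \circ \mu_{TA}$ and $\mu_A \circ \eta_{TA} = \mathrm{id}_{TA} = \mu_A \circ T\eta_A$ for every object $A$. The category $\mathbb{C}$ is regarded as a monoidal category via its finite products, with terminal object $\mathbf{1}$ as neutral object, associator $\alpha_{A,B,C} : (A \times B) \times C \to A \times (B \times C)$ and left unitor $\lambda_A = \pi_2 : \mathbf{1} \times A \to A$. The monad is (left) strong if it is equipped with a natural transformation $\mathrm{lst}_{A,B} : A \times TB \to T(A \times B)$ (the left strength) such that for all objects $A, B, C$: $T(\alpha_{A,B,C}) \circ \mathrm{lst}_{A \times B,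 C} = \mathrm{lst}_{A, B \times C} \circ (\mathrm{id}_A \times \mathrm{lst}_{B,C}) \circ \alpha_{A,B,TC}$; $T(\lambda_A) \circ \mathrm{lst}_{\mathbf{1},A} = \lambda_{TA}$; $\mathrm{lst}_{A,B} \circ (\mathrm{id}_A \times \eta_B) = \eta_{A \times B}$; and $\mu_{A \times B} \circ T\mathrm{lst}_{A,B} \circ \mathrm{lst}_{A,TB} = \mathrm{lst}_{A,B} \circ (\mathrm{id}_A \times \mu_B)$. The Eilenberg–Moore category $\mathbb{C}^{\mathcal{T}}$ has as objects the $\mathcal{T}$-algebras, i.e. pairs $\bar{A} = (A, f_A)$ with $A$ an object of $\mathbb{C}$ and $f_A : TA \to A$ a morphism of $\mathbb{C}$ such that $f_A \circ \eta_A = \mathrm{id}_A$ and $f_A \circ \mu_A = f_A \circ T f_A$. Its morphisms $(A, f_A) \to (B, f_B)$ are the morphisms $f : A \to B$ of $\mathbb{C}$ with $f \circ f_A = f_B \circ Tf$. For objects $X, Y$ of $\mathbb{C}$, $\mathrm{Hom}_{\mathbb{C}}(X, Y)$ denotes the collection of morphisms from $X$ to $Y$ in $\mathbb{C}$. For an object $C$ of $\mathbb{C}$ and $\mathcal{T}$-algebras $\bar{A} = (A, f_A)$, $\bar{B} = (B, f_B)$, $\mathrm{AHom}_{\mathbb{C}}(C \times \bar{A}, \bar{B})$ denotes the collection of morphisms $f : C \times A \to B$ in $\mathbb{C}$ that are $\mathcal{T}$-algebra homomorphisms in their right-hand argument, i.e. such that $f \circ (\mathrm{id}_C \times f_A)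 = f_B \circ Tf \circ \mathrm{lst}_{C,A}$ as morphisms $C \times TA \to B$. (The expression $C \times \bar{A}$ is only notation.) *)

(* Defs.v *)
From mathcomp Require Import ssreflect ssrfun ssrbool.

Set Implicit Arguments.
Unset Strict Implicit.
Unset Printing Implicit Defensive.

Declare Scope cat_scope.
Delimit Scope cat_scope with cat.
Local Open Scope cat_scope.

Reserved Notation "g ∘ f" (at level 40, left associativity).
Reserved Notation "A × B" (at level 40, left associativity).
Reserved Notation "f ×m g" (at level 40, left associativity).

Record category := Category {
  ob :> Type;
  hom : ob -> ob -> Type;
  idm : forall X, hom X X;
  compose : forall X Y Z, hom Y Z -> hom X Y -> hom X Z;
  compose_idl : forall X Y (f : hom X Y), compose (idm Y) f = f;
  compose_idr : forall X Y (f : hom X Y), compose f (idm X) = f;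
  composeA : forall W X Y Z (h : hom Y Z) (g : hom X Y) (f : hom W X),
    compose h (compose g f) = compose (compose h g) f
}.

Arguments hom {c} X Y.
Arguments idm {c} X.
Arguments compose {c X Y Z} g f.
Notation "g ∘ f" := (compose g f) : cat_scope.

Record functor (C D : category) := Functor {
  fobj :> C -> D;
  fmap : forall X Y : C, hom X Y -> hom (fobj X) (fobj Y);
  fmap_id : forall X : C, fmap (idm X) = idm (fobj X);
  fmap_comp : forall (X Y Z : C) (g : hom Y Z) (f : hom X Y),
    fmap (g ∘ f) = fmap g ∘ fmap f
}.

Arguments fmap {C D} _ {X Y} _.

Definition functor_id (C : category) : functor C C :=
  @Functor C C (fun X => X) (fun X Y f => f)
    (fun X => erefl) (fun X Y Z g f => erefl).

Lemma functor_comp_id (C D E : category) (G : functor D E) (F : functor C D)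
  (X : C) : fmap G (fmap F (idm X)) = idm (G (F X)).
Proof. by rewrite !fmap_id. Qed.

Lemma functor_comp_comp (C D E : category) (G : functor D E) (F : functor C D)
  (X Y Z : C) (g : hom Y Z) (f : hom X Y) :
  fmap G (fmap F (g ∘ f)) = fmap G (fmap F g) ∘ fmap G (fmap F f).
Proof. by rewrite !fmap_comp. Qed.

Definition functor_comp (C D E : category) (G : functor D E)
    (F : functor C D) : functor C E :=
  @Functor C E (fun X => G (F X)) (fun X Y f => fmap G (fmap F f))
    (functor_comp_id G F) (@functor_comp_comp C D E G F).

Record nat_trans (C D : category) (F G : functor C D) := NatTrans {
  component :> forall X : C, hom (F X) (G X);
  naturality : forall (X Y : C) (f : hom X Y),
    component Y ∘ fmap F f = fmap G f ∘ component X
}.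

Record monad (C : category) := Monad {
  monad_functor :> functor C C;
  eta : nat_trans (functor_id C) monad_functor;
  mu : nat_trans (functor_comp monad_functor monad_functor) monad_functor;
  mu_assoc : forall A : C,
    mu A ∘ fmap monad_functor (mu A) = mu A ∘ mu (monad_functor A);
  mu_etal : forall A : C,
    mu A ∘ eta (monad_functor A) = idm (monad_functor A);
  mu_etar : forall A : C,
    mu A ∘ fmap monad_functor (eta A) = idm (monad_functor A)
}.

(* The Eilenberg-Moore algebras of T, i.e. the objects of its
   Eilenberg-Moore category. *)
Record algebra (C : category) (T : monad C) := Algebra {
  carrier :> C;
  structure_map : hom (T carrier) carrier;
  structure_map_eta : structure_map ∘ eta T carrier = idm carrier;
  structure_map_mu :
    structure_map ∘ mu T carrier = structure_map ∘ fmap T structure_map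
}.

(* Finite products are given by a chosen terminal object and chosen binary
   products, which the types of the strength and of its coherence laws need. *)
Record cartesian_category := CartesianCategory {
  cart_cat :> category;
  terminal : cart_cat;
  to_terminal : forall X : cart_cat, hom X terminal;
  to_terminal_uniq : forall (X : cart_cat) (f : hom X terminal), f = to_terminal X;
  product : cart_cat -> cart_cat -> cart_cat;
  pr1 : forall A B : cart_cat, hom (product A B) A;
  pr2 : forall A B : cart_cat, hom (product A B) B;
  pairing : forall X A B : cart_cat, hom X A -> hom X B -> hom X (product A B);
  pr1_pairing : forall (X A B : cart_cat) (f : hom X A) (g : hom X B),
    pr1 A B ∘ pairing f g = f;
  pr2_pairing : forall (X A B : cart_cat) (f : hom X A) (g : hom X B),
    pr2 A B ∘ pairing f g = g;
  pairing_uniq : forall (X A B : cart_cat) (h : hom X (product A B)),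
    h = pairing (pr1 A B ∘ h) (pr2 A B ∘ h)
}.

Arguments product {c} A B.
Arguments pr1 {c} A B.
Arguments pr2 {c} A B.
Arguments pairing {c X A B} f g.
Notation "A × B" := (product A B) : cat_scope.

Definition product_map (C : cartesian_category) (A A' B B' : C)
    (f : hom A A') (g : hom B B') : hom (A × B) (A' × B') :=
  pairing (f ∘ pr1 A B) (g ∘ pr2 A B).
Notation "f ×m g" := (product_map f g) : cat_scope.

Definition associator (C : cartesian_category) (A B D : C) :
    hom ((A × B) × D) (A × (B × D)) :=
  pairing (pr1 A B ∘ pr1 (A × B) D)
    (pairing (pr2 A B ∘ pr1 (A × B) D) (pr2 (A × B) D)).

Definition left_unitor (C : cartesian_category) (A : C) : hom (terminal C × A) A :=
  pr2 (terminal C) A.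

Definition has_equalizers (C : category) : Prop :=
  forall (X Y : C) (f g : hom X Y),
  exists (E : C) (e : hom E X), f ∘ e = g ∘ e /\
    forall (Z : C) (h : hom Z X), f ∘ h = g ∘ h ->
    exists! k : hom Z E, e ∘ k = h.

Definition has_exponents (C : cartesian_category) : Prop :=
  forall A B : C,
  exists (E : C) (ev : hom (E × A) B),
    forall (X : C) (f : hom (X × A) B),
    exists! g : hom X E, ev ∘ (g ×m idm A) = f.

Record left_strength (C : cartesian_category) (T : monad C) := LeftStrength {
  lst :> forall A B : C, hom (A × T B) (T (A × B));
  lst_natural : forall (A A' B B' : C) (f : hom A A') (g : hom B B'),
    lst A' B' ∘ (f ×m fmap T g) = fmap T (f ×m g) ∘ lst A B;
  lst_associator : forall A B D : C,
    fmap T (associator A B D) ∘ lst (A × B) D =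
    lst A (B × D) ∘ (idm A ×m lst B D) ∘ associator A B (T D);
  lst_left_unitor : forall A : C,
    fmap T (left_unitor A) ∘ lst (terminal C) A = left_unitor (T A);
  lst_eta : forall A B : C,
    lst A B ∘ (idm A ×m eta T B) = eta T (A × B);
  lst_mu : forall A B : C,
    mu T (A × B) ∘ fmap T (lst A B) ∘ lst A (T B) =
    lst A B ∘ (idm A ×m mu T B)
}.

Definition right_homomorphism (C : cartesian_category) (T : monad C)
    (s : left_strength T) (X : C) (A B : algebra T)
    (f : hom (X × A) B) : Prop :=
  f ∘ (idm X ×m structure_map A) = structure_map B ∘ fmap T f ∘ s X A.

Definition AHom (C : cartesian_category) (T : monad C)
    (s : left_strength T) (X : C) (A B : algebra T) : Type :=
  {f : hom (X × A) B | right_homomorphism s f}.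

(* Main.v *)
Require Import Defs.
From mathcomp Require Import ssreflect ssrfun ssrbool.
From Stdlib Require Import ProofIrrelevance IndefiniteDescription.

(** The object of algebra homomorphisms is a subobject of the exponential
    [E = B^A], with evaluation [ev : E × A -> B]. Being a homomorphism in the
    right-hand argument is an equation between two maps [X × T A -> B], and
    both sides make sense for the universal map [ev] itself: they are
    [ev ∘ (id × f_A)] and [f_B ∘ T ev ∘ lst]. Transposing them gives two maps
    [u, v : E -> B^(T A)]: [u] precomposes a function with [f_A], and [v]
    applies the strong functor [T] to it and then composes with [f_B].

    For a map [h : X -> E] with uncurrying [f = ev ∘ (h × id)], the two sides
    of the homomorphism equation for [f] are the uncurryings of [u ∘ h] and
    [v ∘ h]; for [v] this is the naturality of the strength in its left
    argument. So [f] is a homomorphism in its right-hand argument exactly when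
    [u ∘ h = v ∘ h] ([right_homomorphism_uncurryP]), that is, when [h] factors,
    uniquely, through the equalizer of [u] and [v]. This equalizer is the
    wanted object; its construction does not mention [X].

    The bijection is built from right to left, as the uncurrying of a map into
    the equalizer is given by a formula. Its inverse is only known to exist
    pointwise, and a choice principle gathers the values into a function
    ([bijective_of_unique_preimages]). Proof irrelevance makes two elements of
    [AHom] equal as soon as the underlying morphisms are. *)

Local Open Scope cat_scope.

Lemma bijective_of_unique_preimages {X Y : Type} (psi : Y -> X) :
  (forall x, exists! y, psi y = x) -> exists phi : X -> Y, bijective phi.
Proof.
move=> psi_bij.
pose inv x := constructive_indefinite_description _ (psi_bij x).
exists (fun x => proj1_sig (inv x)); exists psi => [x | y].
- by case: (proj2_sig (inv x)).
- by case: (proj2_sig (inv (psi y))) => _; apply.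
Qed.

Section Products.
Context {C : cartesian_category}.

Lemma pairing_comp {W X A B : C} (f : hom X A) (g : hom X B) (h : hom W X) :
  pairing f g ∘ h = pairing (f ∘ h) (g ∘ h).
Proof. by rewrite [LHS]pairing_uniq !composeA pr1_pairing pr2_pairing. Qed.

Lemma product_map_comp {A A' A'' B B' B'' : C} (f' : hom A' A'') (f : hom A A')
    (g' : hom B' B'') (g : hom B B') :
  (f' ×m g') ∘ (f ×m g) = (f' ∘ f) ×m (g' ∘ g).
Proof.
by rewrite /product_map pairing_comp -!composeA pr1_pairing pr2_pairing.
Qed.

End Products.

Section Exponentials.
Context {C : cartesian_category}.

Definition uncurry {E A B : C} (ev : hom (E × A) B) {X : C} (h : hom X E) :
    hom (X × A) B :=
  ev ∘ (h ×m idm A).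

Definition is_evaluation {E A B : C} (ev : hom (E × A) B) : Prop :=
  forall (X : C) (f : hom (X × A) B), exists! h : hom X E, uncurry ev h = f.

Lemma uncurry_comp {E A B : C} (ev : hom (E × A) B) {W X : C} (h : hom X E)
    (k : hom W X) :
  uncurry ev (h ∘ k) = uncurry ev h ∘ (k ×m idm A).
Proof. by rewrite /uncurry -composeA product_map_comp compose_idl. Qed.

Lemma uncurry_inj {E A B : C} (ev : hom (E × A) B) {X : C} :
  is_evaluation ev -> injective (fun h : hom X E => uncurry ev h).
Proof.
move=> evP h h' eq_h.
by have [k [_ k_uniq]] := evP X (uncurry ev h'); rewrite -(k_uniq h) // (k_uniq h').
Qed.

End Exponentials.

Section HomomorphismObject.
Context {C : cartesian_category} {T : monad C} (s : left_strength T).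

Lemma lst_natural_left {X Y A : C} (h : hom X Y) :
  s Y A ∘ (h ×m idm (T A)) = fmap T (h ×m idm A) ∘ s X A.
Proof. by rewrite -lst_natural fmap_id. Qed.

(** Both sides of the homomorphism equation for [uncurry ev h] arise from those
    for [ev] by precomposition with [h × id], so the equation can be moved
    across the transposition along [ev']. *)
Lemma right_homomorphism_uncurryP {A B : algebra T} {E E' : C}
    (ev : hom (E × A) B) (ev' : hom (E' × T A) B) (u v : hom E E') :
  is_evaluation ev' ->
  uncurry ev' u = ev ∘ (idm E ×m structure_map A) ->
  uncurry ev' v = structure_map B ∘ fmap T ev ∘ s E A ->
  forall (X : C) (h : hom X E),
    right_homomorphism s (uncurry ev h) <-> u ∘ h = v ∘ h.
Proof.
move=> ev'P uE vE X h.
have lhsE : uncurry ev h ∘ (idm X ×m structure_map A) = uncurry ev' (u ∘ h).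
  rewrite uncurry_comp uE /uncurry -!composeA !product_map_comp.
  by rewrite !compose_idl !compose_idr.
have rhsE :
    structure_map B ∘ fmap T (uncurry ev h) ∘ s X A = uncurry ev' (v ∘ h).
  by rewrite uncurry_comp vE -!composeA lst_natural_left fmap_comp !composeA.
rewrite /right_homomorphism lhsE rhsE.
by split=> [/(uncurry_inj _ ev'P) | ->].
Qed.

End HomomorphismObject.

Theorem theorem4 (CC : cartesian_category)
    (equalizers : has_equalizers CC) (exponents : has_exponents CC)
    (T : monad CC) (s : left_strength T) (A B : algebra T) :
  exists lolli : CC, forall C : CC,
  exists phi : AHom s C A B -> hom C lolli, bijective phi.
Proof.
have [E [ev evP]] := exponents A B.
have [E' [ev' ev'P]] := exponents (T A) B.
have [u [uE _]] := ev'P _ (ev ∘ (idm E ×m structure_map A)).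
have [v [vE _]] := ev'P _ (structure_map B ∘ fmap T ev ∘ s E A).
have homP := right_homomorphism_uncurryP s ev ev' u v ev'P uE vE.
have [L [e [eq_e e_univ]]] := equalizers _ _ u v.
exists L => X.
have hom_e (k : hom X L) : right_homomorphism s (uncurry ev (e ∘ k)).
  by apply/homP; rewrite !composeA eq_e.
apply: (bijective_of_unique_preimages
          (fun k : hom X L => exist _ (uncurry ev (e ∘ k)) (hom_e k))).
move=> [f f_hom].
have [h [hE _]] := evP X f.
have h_eq : u ∘ h = v ∘ h by apply/homP; rewrite /uncurry hE.
have [k [kE k_uniq]] := e_univ X h h_eq.
exists k; split=> [|k' /(f_equal (@proj1_sig _ _)) /= k'E].
- by apply: subset_eq_compat; rewrite kE.
- by apply/k_uniq/(uncurry_inj ev evP); rewrite k'E -hE.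
Qed.
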